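(* Let $\phi:[-2,0]\to\mathbb{R}$ be a function such that the ranges of $\phi|_{[-2,-1]}$ and of $\phi|_{[-1,0]}$ both equal $[-10,10]$ and $\phi(0)=0$. Consider the problem of minimizing \[ \int_0^1 |x(t)-2t|^2+u(t)\,\mathrm{d}t+4|x(1)-2| \] over pairs $(x,u)$ with $u\in L^\infty(0,1)$, $-1\le u(t)\le 3$ for a.e. $t\in(0,1)$, and $x\in C([-2,1])\cap W^{1,\infty}(0,1)$ satisfying \[ x'(t)=\frac1{10}\max_{s\in[t-2,t]}\big(u(t)\,x(s)\big)\ \text{ for a.e. } t\in(0,1),\qquad x(t)=\phi(t)\ \text{ for } t\in[-2,0]. \] Then this problem does not possess a solution. *)

(* Defs.v *)
From HB Require Import structures.
From mathcomp Require Import all_boot all_order all_algebra.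
From mathcomp Require Import all_classical all_reals all_analysis.
Set Implicit Arguments. Unset Strict Implicit. Unset Printing Implicit Defensive.
Import Order.TTheory GRing.Theory Num.Theory.
Import numFieldNormedType.Exports.
Local Open Scope classical_set_scope.
Local Open Scope ring_scope.

(* W^{1,oo}(0,1) for a (continuous) function: Lipschitz on [0,1]. *)
Definition W1inf01 (R : realType) (x : R -> R) : Prop :=
  exists L : R, forall s t, `[0, 1]%classic s -> `[0, 1]%classic t ->
    `|x s - x t| <= L * `|s - t|.

Definition rhs (R : realType) (x u : R -> R) (t : R) : R :=
  (sup [set u t * x s | s in `[t - 2, t]%classic]) / 10.

Definition control_bounds (R : realType) (u : R -> R) : Prop :=
  {ae @lebesgue_measure R, forall t, `]0, 1[%classic t -> -1 <= u t <= 3}.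

Definition delay_ode (R : realType) (x u : R -> R) : Prop :=
  {ae @lebesgue_measure R, forall t, `]0, 1[%classic t ->
     derivable x t 1 /\ 'D_1 x t = rhs x u t}.

Definition admissible (R : realType) (phi : R -> R) (x u : R -> R) : Prop :=
  [/\ measurable_fun (`]0, 1[%classic : set R) u /\ control_bounds u,
      {within `[-2, 1]%classic, continuous x}, W1inf01 x, delay_ode x u &
      (forall t, `[-2, 0]%classic t -> x t = phi t)].

Definition cost (R : realType) (x u : R -> R) : \bar R :=
  (\int[@lebesgue_measure R]_(t in (`[0%R, 1%R]%classic : set R)) (((`|x t - 2 * t| ^+ 2 + u t)%R)%:E)
   + ((4 * `|x 1 - 2|)%R)%:E)%E.

(* Main.v *)
(* The history takes both values 10 and -10 on [-1, 0], a set which every delay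
   window [t - 2, t] contains, and admissible states stay in [-10, 10]; hence the
   delay equation reduces to x' = |u| with x(0) = 0.  On [-1, 3] one has
   u >= 2 |u| - 3, with equality only at the endpoints, so the cost is at least
     int |x - 2t|^2 + 2 x(1) - 3 + 4 |x(1) - 2| >= 1 + int |x - 2t|^2.
   If the last integral vanishes then x(t) = 2t, which forces u = 2 a.e. and cost
   2: every admissible cost exceeds 1.  Controls switching rapidly between 3 and
   -1 keep x close to 2t with average control 1, so the infimum is 1. *)

Require Import Defs.
From HB Require Import structures.
From mathcomp Require Import all_boot all_order all_algebra.
From mathcomp Require Import all_classical all_reals all_analysis.
From mathcomp Require Import measurable_realfun lra.
Set Implicit Arguments.
Unset Strict Implicit.
Import Order.TTheory GRing.Theory Num.Theory.
Import numFieldNormedType.Exports.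
Local Open Scope classical_set_scope.
Local Open Scope ring_scope.

(** * Almost-everywhere implications and one-sided monotonicity criteria *)

Lemma ae_imply (R : realType) (P Q : R -> Prop) : (forall t, P t -> Q t) ->
  {ae @lebesgue_measure R, forall t, P t} ->
  {ae @lebesgue_measure R, forall t, Q t}.
Proof.
by move=> PQ; apply: filterS => //; exact: (ae_filter_ringOfSetsType (@lebesgue_measure R)).
Qed.

Lemma ae_imply2 (R : realType) (P Q S : R -> Prop) :
  (forall t, P t -> Q t -> S t) ->
  {ae @lebesgue_measure R, forall t, P t} ->
  {ae @lebesgue_measure R, forall t, Q t} ->
  {ae @lebesgue_measure R, forall t, S t}.
Proof.
by move=> PQS; apply: filterS2 => //; exact: (ae_filter_ringOfSetsType (@lebesgue_measure R)).
Qed.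

(** The difference quotient at [t] has a nonnegative limit, hence stays above [- e] near [t]; the
    slack [e] allows for a zero derivative. *)
Lemma right_lower_bound (R : realType) (f : R -> R) (t e : R) :
  derivable f t 1 -> 0 <= 'D_1 f t -> 0 < e ->
  exists2 d : R, 0 < d & forall r, t < r < t + d -> f t - e * (r - t) <= f r.
Proof.
move=> df D0 e0.
have /cvgrPdist_lt/(_ _ e0)/nbhs_ballP[d /= d0 H] :
  h^-1 *: ((f \o shift t) (h *: (1 : R)) - f t) @[h --> 0^'] --> 'D_1 f t by [].
exists d => // r /andP[tr rd].
have h0 : 0 < r - t by rewrite subr_gt0.
have /H : ball (0 : R) d (r - t).
  by rewrite /ball /= sub0r normrN gtr0_norm// ltrBlDl.
move=> /(_ (lt0r_neq0 h0)); rewrite /= /GRing.scale /= mulr1 subrK => /ltr_distlBl lb.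
have : - e <= (r - t)^-1 * (f r - f t) by lra.
by rewrite ler_pdivlMl//; lra.
Qed.

(** A supremum argument: the Lipschitz bound puts the supremum [c] of the points [t] with
    [g a <= g t] among them, and if [c < b] the local hypothesis at [c] yields a larger such
    point. *)
Lemma lipschitz_right_nondecreasing (R : realType) (g : R -> R) (a b K : R) :
  a <= b ->
  (forall s t, a <= s <= b -> a <= t <= b -> `|g s - g t| <= K * `|s - t|) ->
  (forall t, a <= t < b -> exists2 d : R, 0 < d &
     forall r, t < r < t + d -> r <= b -> g t <= g r) ->
  g a <= g b.
Proof.
move=> ab gK right; pose S := [set t | a <= t <= b /\ g a <= g t].
have Sa : S a by rewrite /S /= lexx ab.
have hS : has_sup S by split; [exists a|exists b => t [/andP[]]].
pose c := sup S.
have ac : a <= c by exact: ub_le_sup hS.2 _ Sa.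
have cb : c <= b by apply: ge_sup => [|t [/andP[]]]//; exists a.
have gc : g a <= g c.
  apply/ler_addgt0Pr => e e0.
  (* Within this distance of [c] the function varies by at most [e]; the added 1 keeps the divisor
     positive. *)
  have e1 : 0 < e / (`|K| + 1) by rewrite divr_gt0// ltr_wpDl.
  have [t [/andP[at_ tb] gt] ct] := sup_adherent e1 hS.
  have tc : t <= c by apply: ub_le_sup hS.2 _ _; rewrite /S /= at_ tb.
  have := gK t c; rewrite at_ tb ac cb => /(_ isT isT).
  rewrite -/c in ct; rewrite [`|t - c|]ler0_norm ?subr_le0//.
  move=> /(le_trans (ler_norm _)) gtc.
  have : (K * (c - t)) <= (`|K| + 1) * (e / (`|K| + 1)).
    rewrite (@le_trans _ _ ((`|K| + 1) * (c - t)))//.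
      by rewrite ler_wpM2r ?subr_ge0// (le_trans (ler_norm _))// lerDl.
    by rewrite ler_wpM2l ?addr_ge0//; lra.
  rewrite mulrCA mulfV ?mulr1; last by rewrite lt0r_neq0// ltr_wpDl.
  by move: gtc; rewrite opprB; lra.
have [cb'|] := ltP c b; last by move=> bc; rewrite (_ : b = c)//; apply/le_anti/andP.
have [|d d0 H] := right c; first by rewrite ac.
pose r := Num.min b (c + d / 2).
have cr : c < r by rewrite lt_min cb' ltrDl divr_gt0.
have rb : r <= b by rewrite ge_min lexx.
suff : r <= c by rewrite leNgt cr.
apply: ub_le_sup hS.2 _ _; rewrite /S /= rb (le_trans ac (ltW cr)); split => //.
apply: (le_trans gc); apply: H => //; rewrite cr /=.
by rewrite (@le_lt_trans _ _ (c + d / 2))// ?ge_min ?lexx ?orbT// ltrD2l; lra.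
Qed.

(** * Integrals of bounded functions, and Lipschitz functions recovered from their derivatives *)

Lemma lebesgue_itv_lty (R : realType) (b0 b1 : bool) (s t : R) :
  (@lebesgue_measure R [set` Interval (BSide b0 s) (BSide b1 t)] < +oo)%E.
Proof.
by rewrite lebesgue_measure_itv/=; case: ifP => // _; rewrite -EFinD ltry.
Qed.

Lemma fine_lebesgue_itv (R : realType) (b0 b1 : bool) (s t : R) : s <= t ->
  fine (@lebesgue_measure R [set` Interval (BSide b0 s) (BSide b1 t)]) = t - s.
Proof.
move=> st; rewrite lebesgue_measure_itv/= lte_fin.
case: ltP => [st'|ts]; first by rewrite -EFinD.
by rewrite (_ : s = t) ?subrr//; apply/le_anti/andP.
Qed.

Section BoundedIntegral.
Context (R : realType) (g : R -> R) (a M : R).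
Hypothesis mg : measurable_fun setT g.
Hypothesis gM : forall t, `|g t| <= M.
Local Notation mu := (@lebesgue_measure R).

Lemma bounded_integrable (A : set R) : measurable A -> (mu A < +oo)%E ->
  mu.-integrable A (EFin \o g).
Proof.
move=> mA Aoo; apply: measurable_bounded_integrable => //.
  exact: measurable_funTS.
by exists M; split; [exact: num_real|move=> x Mx t _ /=; rewrite (le_trans _ (ltW Mx))].
Qed.

Lemma bounded_integrable_itv (b0 b1 : bool) (s t : R) :
  mu.-integrable [set` Interval (BSide b0 s) (BSide b1 t)] (EFin \o g).
Proof. by apply: bounded_integrable => //; exact: lebesgue_itv_lty. Qed.

Lemma Rintegral_bounded_sub (s t : R) : a <= s -> s <= t ->
  \int[mu]_(y in `[a, t]) g y - \int[mu]_(y in `[a, s]) g y =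
  \int[mu]_(y in `]s, t]) g y.
Proof.
by move=> as_ st; rewrite Rintegral_itvB ?bnd_simp//; exact: bounded_integrable_itv.
Qed.

Lemma Rintegral_bounded_lipschitz (s t : R) : a <= s -> a <= t ->
  `|\int[mu]_(y in `[a, s]) g y - \int[mu]_(y in `[a, t]) g y| <= M * `|s - t|.
Proof.
wlog st : s t / s <= t => [H as_ at_|as_ at_].
  case: (leP s t) => st; first exact: H.
  by rewrite distrC (distrC s); apply: H => //; exact: ltW.
rewrite distrC Rintegral_bounded_sub//.
have h := bounded_integrable_itv false false s t.
rewrite (le_trans (le_normr_Rintegral _ _))//.
rewrite (@le_trans _ _ (\int[mu]_(y in `]s, t]) M))//.
  apply: le_Rintegral => //.
    exact: integrable_norm.
  apply: measurable_bounded_integrable => //.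
    exact: lebesgue_itv_lty.
  by exists `|M|; split; [exact: num_real|move=> x Mx y _ /=; exact: ltW].
by rewrite Rintegral_cst// fine_lebesgue_itv// distrC ger0_norm ?subr_ge0.
Qed.

(** Lebesgue differentiation; the global bound on [g] provides local integrability. *)
Lemma Rintegral_bounded_ae_derive : {ae mu, forall t, a < t ->
  derivable (fun t => \int[mu]_(y in `[a, t]) g y) t 1 /\
  'D_1 (fun t => \int[mu]_(y in `[a, t]) g y) t = g t}.
Proof.
have lg : locally_integrable setT g.
  split=> //; first exact: openT.
  move=> K _ cK; have mK := compact_measurable cK.
  have := bounded_integrable mK (compact_finite_measure cK).
  by move=> /integrableP[].
have := FTC1 (fun y => bounded_integrable_itv true false a y) lg.
by apply: ae_imply => t H at_; have [] := H at_; rewrite derive1E.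
Qed.

End BoundedIntegral.

(* Cover the exceptional null set by an open set [U] of measure at most [e].
   The function [f t + e (t - a) + |K| mu (U `&` [a, t])] does not decrease to
   the right of any point: off [U] because [f' >= 0], and on [U] because the
   last term then has slope [|K|]. *)
Lemma lipschitz_le_of_ae_derive_ge0 (R : realType) (f : R -> R) (a b K : R) :
  a <= b ->
  (forall s t, a <= s <= b -> a <= t <= b -> `|f s - f t| <= K * `|s - t|) ->
  {ae @lebesgue_measure R, forall t, a < t < b ->
    derivable f t 1 /\ 0 <= 'D_1 f t} ->
  f a <= f b.
Proof.
move=> ab fK [N [mN N0 subN]].
(* The derivative hypothesis covers only the open interval, so [a] is made exceptional too: a point
   of [[a, b]] outside [U] then lies strictly to the right of [a]. *)
pose N' := N `|` [set a].
have mN' : measurable N' by apply: measurableU.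
have N'0 : lebesgue_measure N' = 0%E by rewrite measureU0//; exact: lebesgue_measure_set1.
(* The error is what gets added to [f] over [[a, b]]: [e (b - a)] from the linear term and at most
   [|K| e] from the measure term. *)
suff main e : 0 < e -> f a <= f b + e * (b - a + `|K|).
  apply/ler_addgt0Pr => e e0; pose c := b - a + `|K| + 1.
  have c0 : 0 < c by rewrite ltr_wpDl// addr_ge0// subr_ge0.
  apply: (le_trans (main (e / c) (divr_gt0 e0 c0))).
  rewrite lerD2l mulrAC ler_pdivrMr// ler_pM2l// /c; lra.
move=> e0.
have N'oo : (lebesgue_measure N' < +oo)%E by rewrite N'0.
have [U [oU N'U Ue]] := lebesgue_regularity_outer mN' N'oo e0.
have mU : measurable U := open_measurable oU.
have {}Ue : (lebesgue_measure U <= e%:E)%E.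
  rewrite -(setDUK N'U) measureU//; [|exact: measurableD|exact: setDIK].
  by rewrite [X in (X + _)%E]N'0 add0e ltW.
pose g : R -> R := \1_U.
have mg : measurable_fun setT g by exact: measurable_indic.
have g1 t : `|g t| <= 1.
  by rewrite /g indicE; case: (t \in U); rewrite ?normr0 ?normr1.
(* The measure of the part of [U] in [[a, t]], written as an integral so that the estimates for
   bounded integrands apply. *)
pose h t := \int[lebesgue_measure]_(y in `[a, t]) g y.
have ha : 0 <= h a by apply: Rintegral_ge0 => t _; rewrite /g indicE.
have hb : h b <= e.
  rewrite /h /Rintegral /g integral_indic//.
  have Ub : (lebesgue_measure (U `&` `[a, b]) <= e%:E)%E.
    by apply: le_trans Ue; apply: le_measure; rewrite ?inE//; exact: measurableI.
  rewrite -lee_fin fineK// ge0_fin_numE//; exact: le_lt_trans Ub (ltry _).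
pose G t := f t + (e * (t - a) + `|K| * h t).
have : G a <= G b.
  apply: (@lipschitz_right_nondecreasing _ G a b (K + (e + `|K|))) => //.
    move=> s t sab tab; rewrite /G opprD addrACA.
    rewrite (le_trans (ler_normD _ _))// mulrDl lerD//; first exact: fK.
    rewrite opprD addrACA (le_trans (ler_normD _ _))// mulrDl lerD//.
      rewrite -mulrBr normrM gtr0_norm//; rewrite opprB addrA subrK.
      by rewrite lexx.
    rewrite -mulrBr normrM normr_id ler_wpM2l//.
    move/andP: sab => [as_ _]; move/andP: tab => [at_ _].
    by have := Rintegral_bounded_lipschitz mg g1 as_ at_; rewrite mul1r.
  move=> t /andP[at_ tb].
  have hm s : t <= s -> h t <= h s.
    move=> ts; rewrite -subr_ge0 (Rintegral_bounded_sub mg g1)//.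
    by apply: Rintegral_ge0 => y _; rewrite /g indicE.
  have [Ut|nUt] := pselect (U t).
    have /nbhs_ballP[d /= d0 dU] : nbhs t U by exact: open_nbhs_nbhs.
    exists d => // r /andP[tr rtd] rb.
    have hr : h r = h t + (r - t).
      rewrite -[LHS](subrK (h t)) addrC; congr (_ + _).
      rewrite (Rintegral_bounded_sub mg g1) ?(ltW tr)//.
      rewrite (@eq_Rintegral _ _ _ _ _ (cst 1)).
        by rewrite Rintegral_cst// fine_lebesgue_itv ?(ltW tr)// mul1r.
      move=> y; rewrite inE /= in_itv /= => /andP[ty yr].
      rewrite /g indicE mem_set//; apply: dU; rewrite /ball /= distrC.
      by rewrite gtr0_norm ?subr_gt0// ltrBlDl; exact: le_lt_trans rtd.
    have := fK t r; rewrite at_ (ltW tb) rb (ltW (le_lt_trans at_ tr)).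
    move=> /(_ isT isT)/(le_trans (ler_norm _)).
    rewrite distrC gtr0_norm ?subr_gt0// => ft.
    have KK : K * (r - t) <= `|K| * (r - t).
      by rewrite ler_wpM2r ?ler_norm// subr_ge0 ltW.
    have er : 0 <= e * (r - t) by rewrite mulr_ge0 ?ltW// subr_gt0.
    by rewrite /G hr; lra.
  have nN : ~ N t by move=> Nt; apply: nUt; apply: N'U; left.
  have ta : a < t.
    by rewrite lt_neqAle at_ andbT; apply/eqP => ta; apply: nUt; apply: N'U; right.
  have [|df D0] : a < t < b -> derivable f t 1 /\ 0 <= 'D_1 f t.
  - by apply: contrapT => /= H; apply: nN; apply: subN.
  - by rewrite ta tb.
  have [d d0 H] := right_lower_bound df D0 e0.
  exists d => // r rtd rb; have := H r rtd.
  have tr : t <= r by case/andP: rtd => /ltW.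
  have : `|K| * h t <= `|K| * h r by rewrite ler_wpM2l// hm.
  rewrite /G; lra.
rewrite /G subrr mulr0 add0r => Gab.
have : `|K| * h b <= `|K| * e by rewrite ler_wpM2l.
have : 0 <= `|K| * h a by rewrite mulr_ge0.
lra.
Qed.

Lemma lipschitz_increment_le (R : realType) (f g : R -> R) (a b K M : R) :
  a <= b ->
  (forall s t, a <= s <= b -> a <= t <= b -> `|f s - f t| <= K * `|s - t|) ->
  (forall s t, a <= s <= b -> a <= t <= b -> `|g s - g t| <= M * `|s - t|) ->
  {ae @lebesgue_measure R, forall t, a < t < b ->
    [/\ derivable f t 1, derivable g t 1 & 'D_1 f t <= 'D_1 g t]} ->
  f b - f a <= g b - g a.
Proof.
move=> ab fK gM H.
suff : g a - f a <= g b - f b by lra.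
apply: (@lipschitz_le_of_ae_derive_ge0 _ (g - f) a b (M + K)) => //.
  move=> s t sab tab; rewrite /= opprD opprK addrACA (addrC (- f s)).
  by rewrite (le_trans (ler_normD _ _))// mulrDl lerD ?gM// distrC fK.
apply: ae_imply H => t H /H[df dg fg]; split; first exact: derivableB.
by rewrite deriveB// subr_ge0.
Qed.

(** The primitive of [g] is Lipschitz and has the derivative of [f] almost everywhere; comparing
    increments in both directions gives equality. *)
Lemma lipschitz_FTC (R : realType) (f g : R -> R) (a b K M : R) :
  a <= b ->
  (forall s t, a <= s <= b -> a <= t <= b -> `|f s - f t| <= K * `|s - t|) ->
  measurable_fun setT g -> (forall t, `|g t| <= M) ->
  {ae @lebesgue_measure R, forall t, a < t < b ->
    derivable f t 1 /\ 'D_1 f t = g t} ->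
  f b - f a = \int[lebesgue_measure]_(t in `[a, b]) g t.
Proof.
move=> ab fK mg gM Hf.
pose G t := \int[lebesgue_measure]_(y in `[a, t]) g y.
have Ga : G a = 0 by rewrite /G set_itv1 Rintegral_set1.
have GM s t : a <= s <= b -> a <= t <= b -> `|G s - G t| <= M * `|s - t|.
  by move=> /andP[as_ _] /andP[at_ _]; exact: Rintegral_bounded_lipschitz.
have HG := Rintegral_bounded_ae_derive a mg gM.
rewrite -/(G b) -[RHS]subr0 -Ga; apply/le_anti/andP; split.
  apply: (lipschitz_increment_le ab fK GM); apply: ae_imply2 Hf HG => t.
  by move=> H1 H2 /andP[at_ tb]; have [|? ->] := H1; [rewrite at_|have [? ->] := H2 at_].
apply: (lipschitz_increment_le ab GM fK); apply: ae_imply2 Hf HG => t.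
by move=> H1 H2 /andP[at_ tb]; have [|? ->] := H1; [rewrite at_|have [? ->] := H2 at_].
Qed.

(** * The cost as a sum of real integrals *)

(** Extending [u] beyond the open interval and truncating at -1 and 3 turns almost-everywhere bounds
    into bounds at every point, as the results on bounded integrands require. *)
Lemma control_bounded_representative (R : realType) (u : R -> R) :
  measurable_fun (`]0, 1[%classic : set R) u -> control_bounds u ->
  exists v : R -> R, [/\ measurable_fun setT v, forall t, -1 <= v t <= 3 &
    {ae @lebesgue_measure R, forall t, 0 < t < 1 -> u t = v t}].
Proof.
move=> mu ub.
exists (fun t => Num.max (-1) (Num.min 3 ((u \_ `]0, 1[%classic) t))); split.
- apply: measurable_maxr => //; apply: measurable_minr => //.
  by apply/(measurable_restrictT _ _).1.
- move=> t; rewrite le_max lexx /= ge_max ge_min lexx andbT.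
  lra.
- apply: ae_imply ub => t H t01; have /andP[u1 u3] := H t01.
  by rewrite patchE mem_set// (min_idPr _)// (max_idPr _).
Qed.

Definition tracking_error (R : realType) (x : R -> R) (t : R) : R :=
  `|x t - 2 * t| ^+ 2.

Section Cost.
Context (R : realType) (x : R -> R).
Hypothesis cx : {within `[0, 1], continuous x}.
Local Notation mu := (@lebesgue_measure R).

Lemma tracking_error_within_continuous :
  {within `[0, 1], continuous (tracking_error x)}.
Proof.
have -> : tracking_error x = (fun t => (x t - 2 * t) * (x t - 2 * t)).
  by apply/funext => t; rewrite /tracking_error real_normK ?num_real// expr2.
suff c t : {for t, continuous ((fun t => x t - 2 * t) : subspace `[0, 1] -> R)}.
  by move=> t; exact: continuousM (c t) (c t).
apply: continuousB; first exact: cx.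
by apply: continuous_subspaceT; exact: mulrl_continuous.
Qed.

Lemma tracking_error_integrable :
  mu.-integrable `[0, 1] (EFin \o tracking_error x).
Proof.
apply: continuous_compact_integrable; first exact: segment_compact.
exact: tracking_error_within_continuous.
Qed.

(** Both sides are moved to the open interval, the only place where [u] is constrained; there [v]
    replaces [u] up to a null set. All integrals are finite, so the cost is a real number. *)
Lemma costE (u v : R -> R) :
  measurable_fun (`]0, 1[%classic : set R) u ->
  measurable_fun setT v -> (forall t, -1 <= v t <= 3) ->
  {ae mu, forall t, 0 < t < 1 -> u t = v t} ->
  cost x u = (\int[mu]_(t in `[0, 1]) tracking_error x t
    + \int[mu]_(t in `[0, 1]) v t + 4 * `|x 1 - 2|)%:E.
Proof.
move=> mu_ mv vb uv.
have iw := tracking_error_integrable.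
have v3 t : `|v t| <= 3 by rewrite ler_norml; have := vb t; lra.
have iv : mu.-integrable `[0, 1] (EFin \o v) by exact: bounded_integrable_itv v3 _ _ _ _.
rewrite /cost EFinD; congr (_ + _)%E.
have mw : measurable_fun (`]0, 1[%classic : set R) (tracking_error x).
  have /integrableP[/measurable_EFinP mw _] := iw.
  by apply: measurable_funS mw => //; exact: subset_itv_oo_cc.
rewrite -RintegralD// fineK; last first.
  by apply: integrable_fin_num => //; exact: (@integrableD _ _ R mu _ _ _ _ iw iv).
rewrite integral_itv_bndoo; last by apply/measurable_EFinP; exact: measurable_funD.
rewrite [RHS]integral_itv_bndoo; last first.
  by apply/measurable_EFinP; apply: measurable_funD => //; exact: measurable_funTS.
apply: ae_eq_integral => //.
- by apply/measurable_EFinP; apply: measurable_funD.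
- by apply/measurable_EFinP; apply: measurable_funD => //; exact: measurable_funTS.
- apply: ae_imply uv => t H t01; rewrite /tracking_error H//.
Qed.

End Cost.

(** * The delay equation and its reduction to [x' = |u|] *)

(** The window [[t - 2, t]] lies in [[-2, 1]] and contains [[-1, 0]], where [u t * x s] takes the
    value [10 |u t|]: choose [x s = 10] or [x s = -10] by the sign of [u t]. A general [M] is kept
    because the bound 10 on states is itself derived from this estimate. *)
Lemma rhs_bounds (R : realType) (x u : R -> R) (t M : R) :
  0 < t < 1 ->
  (exists2 s, -1 <= s <= 0 & x s = 10) -> (exists2 s, -1 <= s <= 0 & x s = -10) ->
  (forall s, -2 <= s <= 1 -> `|x s| <= M) ->
  `|u t| <= rhs x u t <= `|u t| * M / 10.
Proof.
move=> t01 [p pI xp] [q qI xq] xM; rewrite /rhs.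
set A := [set u t * x s | s in _].
(* This also makes [A] bounded above; otherwise [sup] would take its default value 0. *)
have Aub r : A r -> r <= `|u t| * M.
  move=> [s /=]; rewrite in_itv /= => sI <-.
  rewrite (le_trans (ler_norm _))// normrM ler_wpM2l// xM//; lra.
have hA s : -1 <= s <= 0 -> A (u t * x s).
  by move=> sI; exists s => //=; rewrite in_itv /=; lra.
apply/andP; split; last first.
  rewrite ler_pM2r ?invr_gt0//; apply: ge_sup => //.
  by exists (u t * x p); exact: hA.
rewrite ler_pdivlMr//; have [u0|u0] := leP 0 (u t).
  rewrite ger0_norm// -xp; apply: ub_le_sup; last exact: hA.
  by exists (`|u t| * M) => r; exact: Aub.
rewrite ltr0_norm// mulNr -mulrN -xq; apply: ub_le_sup; last exact: hA.
by exists (`|u t| * M) => r; exact: Aub.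
Qed.

(** For [M = 10] the two bounds coincide. *)
Lemma rhs_eq_norm (R : realType) (x u : R -> R) (t : R) :
  0 < t < 1 ->
  (exists2 s, -1 <= s <= 0 & x s = 10) -> (exists2 s, -1 <= s <= 0 & x s = -10) ->
  (forall s, -2 <= s <= 1 -> `|x s| <= 10) ->
  rhs x u t = `|u t|.
Proof.
move=> t01 xp xq xM; have := rhs_bounds u t01 xp xq xM.
by rewrite mulfK ?pnatr_eq0// => H; apply/le_anti; rewrite andbC.
Qed.

Section Problem.
Context (R : realType) (phi : R -> R).
Hypothesis hphi1 : phi @` `[-2, -1]%classic = `[-10, 10]%classic.
Hypothesis hphi2 : phi @` `[-1, 0]%classic = `[-10, 10]%classic.
Hypothesis hphi0 : phi 0 = 0.
Local Notation mu := (@lebesgue_measure R).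

Lemma history_bounded (s : R) : -2 <= s <= 0 -> `|phi s| <= 10.
Proof.
move=> sI; suff : (`[-10, 10]%classic : set R) (phi s).
  by rewrite /= in_itv /= ler_norml.
have [s1|s1] := leP s (-1).
  by rewrite -hphi1; exists s => //=; rewrite in_itv /=; lra.
by rewrite -hphi2; exists s => //=; rewrite in_itv /=; lra.
Qed.

Section Extension.
Variable x : R -> R.
Hypothesis x_phi : forall t, `[-2, 0]%classic t -> x t = phi t.

Lemma history_value (c : R) : -10 <= c <= 10 ->
  exists2 s, -1 <= s <= 0 & x s = c.
Proof.
move=> cI; have : (`[-10, 10]%classic : set R) c by rewrite /= in_itv.
rewrite -hphi2 => -[s /=]; rewrite in_itv /= => sI <-; exists s => //.
by apply: x_phi; rewrite /= in_itv /=; lra.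
Qed.

Lemma extension_bounded (M : R) : 10 <= M ->
  (forall s, 0 <= s <= 1 -> `|x s| <= M) -> forall s, -2 <= s <= 1 -> `|x s| <= M.
Proof.
move=> M10 xM s sI; have [s0|s0] := leP s 0; last by apply: xM; lra.
rewrite x_phi; last by rewrite /= in_itv /=; lra.
by rewrite (le_trans _ M10)// history_bounded//; lra.
Qed.

Lemma extension_rhs_bounds (u : R -> R) (M t : R) : 10 <= M ->
  (forall s, 0 <= s <= 1 -> `|x s| <= M) -> 0 < t < 1 ->
  `|u t| <= rhs x u t <= `|u t| * M / 10.
Proof.
move=> M10 xM t01; apply: rhs_bounds => //.
- by apply: history_value; lra.
- by apply: history_value; lra.
- exact: extension_bounded.
Qed.

End Extension.

Lemma W1inf01P (x : R -> R) : W1inf01 x -> exists K, forall s t,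
  0 <= s <= 1 -> 0 <= t <= 1 -> `|x s - x t| <= K * `|s - t|.
Proof.
by move=> [K xK]; exists K => s t sI tI; apply: xK; rewrite /= in_itv.
Qed.

Lemma delay_odeP (x u : R -> R) : delay_ode x u ->
  {ae mu, forall t, 0 < t < 1 -> derivable x t 1 /\ 'D_1 x t = rhs x u t}.
Proof. by apply: ae_imply => t H t01; apply: H; rewrite /= in_itv. Qed.

Lemma control_boundsP (u : R -> R) : control_bounds u ->
  {ae mu, forall t, 0 < t < 1 -> -1 <= u t <= 3}.
Proof. by apply: ae_imply => t H t01; apply: H; rewrite /= in_itv. Qed.

Section AdmissiblePair.
Variables x u : R -> R.
Hypothesis xu : admissible phi x u.

Lemma admissible_init : x 0 = 0.
Proof.
by case: xu => _ _ _ _ xphi; rewrite xphi ?hphi0//= in_itv /=; lra.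
Qed.

(** Any bound on [x], however large, gives [x' >= |u| >= 0]. *)
Lemma admissible_nondecreasing (s t : R) : 0 <= s -> s <= t -> t <= 1 ->
  x s <= x t.
Proof.
move=> s0 st t1; case: xu => _ _ /W1inf01P[K xK] /delay_odeP ode xphi.
apply: (@lipschitz_le_of_ae_derive_ge0 _ x s t K) => //.
  by move=> p q pI qI; apply: xK; lra.
apply: ae_imply ode => r H rI; have r01 : 0 < r < 1 by lra.
have [? ->] := H r01; split=> //.
(* A provisional bound: 10 accounts for the history, and [|K|] bounds [x] on [[0, 1]] since
   [x 0 = 0]. *)
have M10 : 10 <= 10 + `|K| by rewrite lerDl.
have xM q : 0 <= q <= 1 -> `|x q| <= 10 + `|K|.
  move=> qI; have := xK q 0 qI; rewrite admissible_init !subr0 => /(_ _)/le_trans.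
  apply; first by rewrite lexx ler01.
  rewrite (@le_trans _ _ (`|K| * 1))//; last by rewrite mulr1 lerDr.
  rewrite (le_trans (ler_norm _))// normrM normr_id ler_wpM2l//.
  by rewrite ger0_norm; lra.
have := extension_rhs_bounds xphi u M10 xM r01.
by move=> /andP[+ _]; exact: le_trans.
Qed.

(** By monotonicity [x 1] is the largest value of [|x|] on [[0, 1]]. Were it above 10, it would
    bound [x] on every window, so that [x' <= 3 / 10 * x 1] and hence [x 1 <= 3 / 10 * x 1], which
    is absurd. *)
Lemma admissible_bounded (s : R) : 0 <= s <= 1 -> `|x s| <= 10.
Proof.
move=> sI; have x0 q : 0 <= q <= 1 -> 0 <= x q.
  by move=> qI; rewrite -admissible_init; apply: admissible_nondecreasing; lra.
have x1 q : 0 <= q <= 1 -> x q <= x 1.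
  by move=> qI; apply: admissible_nondecreasing; lra.
rewrite ger0_norm ?x0// (le_trans (x1 _ sI))//.
case: xu => -[_ /control_boundsP ub] _ /W1inf01P[K xK] /delay_odeP ode xphi.
rewrite leNgt; apply/negP => x10.
have xM q : 0 <= q <= 1 -> `|x q| <= x 1.
  by move=> qI; rewrite ger0_norm ?x0 ?x1.
have : x 1 - x 0 <= 3 / 10 * x 1 * 1 - 3 / 10 * x 1 * 0.
  apply: (@lipschitz_increment_le _ x (fun t => 3 / 10 * x 1 * t) 0 1 K
    (3 / 10 * x 1)) => //.
    move=> p q _ _; rewrite -mulrBr normrM ger0_norm//.
    by rewrite mulr_ge0//; lra.
  apply: ae_imply2 ode ub => r H ubr r01; have [dx Dx] := H r01.
  have [d1 d2] : is_derive r 1 (fun t => 3 / 10 * x 1 * t) (3 / 10 * x 1).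
    by apply: is_derive_eq; rewrite scaler1.
  split=> //; rewrite Dx d2.
  have /andP[_ /le_trans] := extension_rhs_bounds xphi u (ltW x10) xM r01.
  apply; have := ubr r01; have [u0|u0] := ger0P (u r) => ur; nra.
rewrite admissible_init; lra.
Qed.

Lemma admissible_derive : {ae mu, forall t, 0 < t < 1 ->
  derivable x t 1 /\ 'D_1 x t = `|u t|}.
Proof.
case: xu => _ _ _ /delay_odeP ode xphi.
apply: ae_imply ode => t H t01; have [? ->] := H t01; split=> //.
apply: rhs_eq_norm => //.
- by apply: history_value => //; lra.
- by apply: history_value => //; lra.
- exact: extension_bounded xphi _ _ admissible_bounded.
Qed.

End AdmissiblePair.
End Problem.

(** * Every admissible cost exceeds 1 *)

(** The integrand is nonnegative, so its integral over each [[0, s]] vanishes too; by continuity the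
    derivative of that integral is the integrand. *)
Lemma tracking_error_eq0 (R : realType) (x : R -> R) :
  {within `[0, 1], continuous x} ->
  \int[lebesgue_measure]_(t in `[0, 1]) tracking_error x t = 0 ->
  forall t, 0 < t < 1 -> x t = 2 * t.
Proof.
move=> cx W0 t /andP[t0 t1].
have iw := tracking_error_integrable cx.
have w0 s : 0 <= tracking_error x s by exact: sqr_ge0.
have [cw _ _] := (continuous_within_itvP _ (@ltr01 R)).1
  (tracking_error_within_continuous cx).
have ct : {for t, continuous (tracking_error x)} by apply: cw; rewrite in_itv /= t0.
have [_ wt] := continuous_FTC1_closed t1 iw t0 ct.
suff : tracking_error x t = 0.
  by move=> /eqP; rewrite /tracking_error sqrf_eq0 normr_eq0 subr_eq0 => /eqP.
rewrite -wt derive1E (@near_eq_derive _ _ _ _ (cst 0)) ?derive_cst//.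
have tI : t \in `]0, 1[ by rewrite in_itv /= t0.
near=> s.
have /andP[s0 s1] : 0 < s < 1.
  by have : s \in `]0, 1[; [near: s; exact: near_in_itvoo|rewrite in_itv].
(* As the total is zero, the integral over [[0, s]] is minus the one over []s, 1]], hence both
   nonnegative and nonpositive. *)
have := Rintegral_itvB (x := s) iw; rewrite !bnd_simp => /(_ (ltW s0) (ltW s1)).
rewrite W0 sub0r => ws; apply/le_anti; rewrite Rintegral_ge0// andbT -oppr_ge0 ws.
exact: Rintegral_ge0.
Unshelve. all: by end_near. Qed.

Section LowerBound.
Context (R : realType) (phi : R -> R).
Hypothesis hphi1 : phi @` `[-2, -1]%classic = `[-10, 10]%classic.
Hypothesis hphi2 : phi @` `[-1, 0]%classic = `[-10, 10]%classic.
Hypothesis hphi0 : phi 0 = 0.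
Local Notation mu := (@lebesgue_measure R).

Lemma cost_gt1 (x u : R -> R) : admissible phi x u ->
  exists2 c, 1 < c & cost x u = c%:E.
Proof.
move=> xu; have [[mu_ ub] cx /W1inf01P[K xK] _ _] := xu.
have [v [mv vb uv]] := control_bounded_representative mu_ ub.
have cx01 : {within `[0, 1], continuous x}.
  apply: continuous_subspaceW cx => t /=; rewrite !in_itv /=; lra.
have v3 t : `|v t| <= 3 by rewrite ler_norml; have := vb t; lra.
have iv : mu.-integrable `[0, 1] (EFin \o v).
  exact: bounded_integrable_itv v3 _ _ _ _.
have x0 := admissible_init hphi0 xu.
have dx := admissible_derive hphi1 hphi2 hphi0 xu.
rewrite (costE cx01 mu_ mv vb uv); eexists; last by [].
set W := \int[mu]_(t in _) tracking_error x t.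
have W0 : 0 <= W by apply: Rintegral_ge0 => t _; exact: sqr_ge0.
have [Wpos|] := ltP 0 W.
  have mnv : measurable_fun setT (fun t => `|v t|).
    by apply: measurableT_comp.
  have nv3 t : `| `|v t| | <= 3 by rewrite normr_id.
  have inv : mu.-integrable `[0, 1] (EFin \o (fun t => `|v t|)).
    exact: bounded_integrable_itv nv3 _ _ _ _.
  have i2nv : mu.-integrable `[0, 1] (EFin \o (fun t => 2 * `|v t|)).
    exact: (@integrableZl _ _ R mu _ _ 2 _ inv).
  have i3 : mu.-integrable `[0, 1] (EFin \o cst (- 3)).
    by apply: (@bounded_integrable_itv _ _ 3) => // t; rewrite normrN ger0_norm.
  have x1 : x 1 - x 0 = \int[mu]_(t in `[0, 1]) `|v t|.
    apply: (lipschitz_FTC ler01 xK mnv nv3).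
    by apply: ae_imply2 dx uv => t Dx uvt t01; rewrite -uvt//; exact: Dx.
  have : \int[mu]_(t in `[0, 1]) (2 * `|v t| + cst (- 3) t)
      <= \int[mu]_(t in `[0, 1]) v t.
    apply: le_Rintegral => //.
      exact: (@integrableD _ _ R mu _ _ _ _ i2nv i3).
    move=> t _ /=; have := vb t.
    by have [v0|v0] := ger0P (v t); lra.
  rewrite RintegralD// RintegralZl// Rintegral_cst// fine_lebesgue_itv//.
  rewrite -x1 x0.
  (* Here [2 * x 1 - 3 + 4 |x 1 - 2| = 1 + 2 (x 1 - 2) + 4 |x 1 - 2| >= 1], and strictness comes
     from [W > 0]. *)
  by have := ler_norm (x 1 - 2); have := normr_ge0 (x 1 - 2);
     have := ler_norm (2 - x 1); rewrite distrC; lra.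
move=> Wle0; have {W0 Wle0}W0 : W = 0 by apply/le_anti; rewrite W0 Wle0.
have x2 := tracking_error_eq0 cx01 W0.
have d2 t : 0 < t < 1 -> 'D_1 x t = 2.
  move=> t01; rewrite (@near_eq_derive _ _ _ _ (fun s : R => 2 * s)); last first.
    near=> s; apply: x2.
    have : s \in `]0, 1[; last by rewrite in_itv.
    by near: s; apply: near_in_itvoo; rewrite in_itv.
  have [_ ->//] : is_derive t 1 (fun s : R => 2 * s) 2.
  by apply: is_derive_eq; rewrite scaler1.
(* From [|u t| = 2] only [u t = 2] remains, since the control is at least -1. *)
have v2 : {ae mu, forall t, 0 < t < 1 -> derivable x t 1 /\ v t = 2}.
  apply: ae_imply2 dx uv => t Dx uvt t01; have [? Dxt] := Dx t01; split => //.
  rewrite -uvt//; have := vb t; rewrite -uvt//.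
  by move: Dxt; rewrite d2//; have [] := ger0P (u t); lra.
(* The identity [x t = 2 * t] is available on the open interval only; the value at 1 comes from
   integrating the derivative. *)
have x1 : x 1 - x 0 = \int[mu]_(t in `[0, 1]) cst 2 t.
  apply: (lipschitz_FTC (M := 2) ler01 xK); rewrite ?measurable_cst//.
    by move=> t; rewrite ger0_norm.
  by apply: ae_imply v2 => t H t01; have [? _] := H t01; rewrite d2.
have {}x1 : x 1 = 2.
  by move: x1; rewrite x0 subr0 Rintegral_cst// fine_lebesgue_itv// subr0 mulr1.
(* Almost everywhere [v] is the derivative of [x] as well, so its integral is 2, and so is the
   cost. *)
have : x 1 - x 0 = \int[mu]_(t in `[0, 1]) v t.
  apply: (lipschitz_FTC ler01 xK mv v3).
  by apply: ae_imply v2 => t H t01; have [? ->] := H t01; rewrite d2.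
rewrite W0 x0 x1 => <-; rewrite !subrr; have := normr_ge0 (0 : R); lra.
Unshelve. all: by end_near. Qed.

End LowerBound.

(** * The distance to the nearest integer *)

Section Sawtooth.
Context (R : realType).
Implicit Types (z : R) (k : int).

Definition sawtooth z : R :=
  Num.min (z - (Num.floor z)%:~R) ((Num.floor z)%:~R + 1 - z).

Lemma floor_bounds z : (Num.floor z)%:~R <= z < (Num.floor z)%:~R + 1.
Proof. by have := floor_itv z; rewrite intrD. Qed.

Lemma sawtooth_ge0 z : 0 <= sawtooth z.
Proof. by rewrite le_min; have := floor_bounds z; lra. Qed.

Lemma sawtooth_le1 z : sawtooth z <= 1.
Proof. by rewrite ge_min; have := floor_bounds z; lra. Qed.

(* [sawtooth z] is the distance from [z] to the integers. *)
Lemma sawtooth_le_dist z k : sawtooth z <= `|z - k%:~R|.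
Proof.
have fz := floor_bounds z; rewrite ge_min.
have [kz|] := leP k (Num.floor z).
  have : (k%:~R : R) <= (Num.floor z)%:~R by rewrite ler_int.
  by have := ler_norm (z - k%:~R); lra.
rewrite -lezD1 => kz.
have : (Num.floor z + 1)%:~R <= (k%:~R : R) by rewrite ler_int.
by rewrite intrD distrC; have := ler_norm (k%:~R - z); lra.
Qed.

Lemma sawtooth_dist z : exists k, sawtooth z = `|z - k%:~R|.
Proof.
have fz := floor_bounds z; rewrite /sawtooth.
have [_|_] := leP (z - (Num.floor z)%:~R) ((Num.floor z)%:~R + 1 - z).
  by exists (Num.floor z); rewrite ger0_norm; lra.
exists (Num.floor z + 1); rewrite intrD distrC ger0_norm; lra.
Qed.

(** An integer nearest to [b] also bounds the distance from [a], by the triangle inequality. *)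
Lemma sawtooth_lipschitz y z : `|sawtooth y - sawtooth z| <= `|y - z|.
Proof.
suff H (a b : R) : sawtooth a <= sawtooth b + `|a - b|.
  by rewrite ler_distl; have := H y z; have := H z y; rewrite (distrC z); lra.
have [k ->] := sawtooth_dist b; rewrite (le_trans (sawtooth_le_dist a k))//.
by rewrite [leRHS]addrC ler_distD.
Qed.

Lemma sawtooth_nat (n : nat) : sawtooth n%:R = 0.
Proof.
apply/le_anti; rewrite sawtooth_ge0 andbT.
by rewrite (le_trans (sawtooth_le_dist _ n))// subrr normr0.
Qed.

End Sawtooth.

(** * Chattering controls and the states they generate *)

Section Chattering.
Context (R : realType) (N : R).
Hypothesis N0 : 0 < N.

(** Each period of length [1 / N] is shared equally by 3 and -1: the mean is 1, while the absolute
    value has mean 2, the slope of the target [2 * t]. *)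
Definition chattering_control (t : R) : R :=
  if N * t - (Num.floor (N * t))%:~R < 1 / 2 then 3 else -1.

(** A primitive of the absolute value of the control: the correction has slopes 1 and -1, giving
    total slopes 3 and 1. *)
Definition chattering_state (t : R) : R := 2 * t + sawtooth (N * t) / N.

Lemma chattering_control_bounds t : -1 <= chattering_control t <= 3.
Proof. by rewrite /chattering_control; case: ifP => _; lra. Qed.

Lemma chattering_control_measurable : measurable_fun setT chattering_control.
Proof.
apply: measurable_fun_ifT => //.
have mN : measurable_fun [set: R] (fun t : R => N * t).
  by apply: measurable_funM => //; exact: measurable_cst.
apply: measurable_fun_ltr => //; apply: measurable_funB => //.
apply: nondecreasing_measurable => // s t st.
by rewrite ler_int; apply: le_floor; rewrite ler_pM2l.
Qed.

Lemma chattering_state_lipschitz s t :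
  `|chattering_state s - chattering_state t| <= 3 * `|s - t|.
Proof.
rewrite /chattering_state opprD addrACA (le_trans (ler_normD _ _))//.
rewrite -mulrBr normrM ger0_norm// -mulrBl normrM (@gtr0_norm _ N^-1) ?invr_gt0//.
suff : `|sawtooth (N * s) - sawtooth (N * t)| / N <= `|s - t| by lra.
rewrite ler_pdivrMr// (le_trans (sawtooth_lipschitz _ _))//.
by rewrite -mulrBr normrM gtr0_norm// mulrC.
Qed.

Lemma chattering_state_tracking t : 0 <= chattering_state t - 2 * t <= N^-1.
Proof.
rewrite /chattering_state addrAC subrr add0r; apply/andP; split.
  by rewrite divr_ge0 ?sawtooth_ge0// ltW.
by rewrite ler_piMl ?sawtooth_le1// invr_ge0 ltW.
Qed.

Lemma chattering_state0 : chattering_state 0 = 0.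
Proof.
by rewrite /chattering_state !mulr0 add0r (sawtooth_nat R 0) mul0r.
Qed.

(** A whole number of periods fits into [[0, 1]], so the deviation from [2 * t] is back to 0 at time
    1. *)
Lemma chattering_state1 (n : nat) : N = n%:R -> chattering_state 1 = 2.
Proof. by move=> NE; rewrite /chattering_state !mulr1 {1}NE sawtooth_nat mul0r addr0. Qed.

(** Corners of the state and jumps of the control occur only where [2 * (N * t)] is an integer;
    elsewhere the state is affine near [t]. *)
Lemma chattering_derive t : (forall k : int, 2 * (N * t) != k%:~R) ->
  derivable chattering_state t 1 /\
  'D_1 chattering_state t = `|chattering_control t|.
Proof.
move=> tk; have Nn0 : N != 0 by rewrite lt0r_neq0.
set k := Num.floor (N * t).
have /andP[kt tk1] := floor_bounds (N * t); rewrite -/k in kt tk1.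
have tk0 : 2 * (N * t) != 2 * k%:~R.
  by have := tk (2 * k); rewrite intrM.
have tk2 : 2 * (N * t) != 2 * k%:~R + 1.
  by have := tk (2 * k + 1); rewrite intrD intrM.
have floork s : k%:~R <= N * s < k%:~R + 1 -> Num.floor (N * s) = k.
  by move=> sk; apply: floor_def; rewrite intrD.
have affine (a b c d : R) : a < N * t < b ->
    (forall s, a < N * s < b -> chattering_state s = c * s + d) ->
    derivable chattering_state t 1 /\ 'D_1 chattering_state t = c.
  move=> abt H.
  have eqH : {near t, chattering_state =1 (fun s : R => c * s + d)}.
    near=> s; apply: H.
    have : s \in `]a / N, b / N[.
      near: s; apply: near_in_itvoo; rewrite in_itv /=.
      by rewrite ltr_pdivrMr// ltr_pdivlMr// mulrC.
    by rewrite in_itv /= ltr_pdivrMr// ltr_pdivlMr// mulrC.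
  have [d1 d2] : is_derive t 1 (fun s : R => c * s + d) c.
    by apply: is_derive_eq; rewrite scaler1 addr0.
  split; first by apply: near_eq_derivable d1; apply: filterS eqH => s ->.
  by rewrite (near_eq_derive _ eqH).
rewrite /chattering_control -/k.
(* The state is [3 * s - k / N] on the first half of the period and [s + (k + 1) / N] on the
   second. *)
have [lt12|ge12] := ltP (N * t - k%:~R) (1 / 2).
  rewrite ger0_norm//; apply: (affine k%:~R (k%:~R + 1 / 2) _ (- (k%:~R / N))).
    by rewrite lt_neqAle kt andbT; apply/andP; split; [apply: contraNN tk0 => /eqP ->|lra].
  move=> s sk; rewrite /chattering_state /sawtooth floork; last by lra.
  rewrite min_l; last by lra.
  by rewrite mulrBl mulrAC mulfV// mul1r; lra.
rewrite normrN normr1; apply: (affine (k%:~R + 1 / 2) (k%:~R + 1) _ ((k%:~R + 1) / N)).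
  rewrite tk1 andbT lt_neqAle; apply/andP; split; last by lra.
  by apply: contraNN tk2 => /eqP <-; apply/eqP; lra.
move=> s sk; rewrite /chattering_state /sawtooth floork; last by lra.
rewrite min_r; last by lra.
by rewrite mulrBl [N * s / N]mulrAC mulfV// mul1r; lra.
Unshelve. all: by end_near. Qed.

(** The exceptional multiples of [1 / (2 * N)] form a countable, hence null, set. *)
Lemma chattering_ae_derive : {ae @lebesgue_measure R, forall t,
  derivable chattering_state t 1 /\
  'D_1 chattering_state t = `|chattering_control t|}.
Proof.
pose A : set R := range (fun k : int => k%:~R / (2 * N)).
have cA : countable A.
  by apply: sub_countable (card_image_le _ _) _; exact: countableP.
exists A; split; first exact: countable_measurable.
  exact: countable_lebesgue_measure0.
have Nn0 : N != 0 by rewrite lt0r_neq0.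
move=> t /= H; apply: contrapT => tA; apply: H; apply: chattering_derive => k.
apply/eqP => tk; apply: tA; exists k => //.
by rewrite -tk mulrA mulrAC mulfV ?mul1r ?mulf_neq0.
Qed.

End Chattering.

(** * The chattering competitor and the nonexistence of minimizers *)

Section Competitor.
Context (R : realType) (phi : R -> R).
Hypothesis hphi1 : phi @` `[-2, -1]%classic = `[-10, 10]%classic.
Hypothesis hphi2 : phi @` `[-1, 0]%classic = `[-10, 10]%classic.
Hypothesis hphi0 : phi 0 = 0.
Hypothesis cphi : {within `[-2, 0], continuous phi}.
Variable N : R.
Hypothesis N0 : 0 < N.
Local Notation mu := (@lebesgue_measure R).
Local Notation u := (chattering_control N).

Definition chattering_extension (t : R) : R :=
  if t <= 0 then phi t else chattering_state N t.

(** The two branches agree at 0, where both vanish. *)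
Lemma chattering_extension_ge0 (t : R) : 0 <= t ->
  chattering_extension t = chattering_state N t.
Proof.
move=> t0; rewrite /chattering_extension; case: ifPn => // t0'.
by rewrite (_ : t = 0) ?hphi0 ?chattering_state0//; apply/le_anti/andP.
Qed.

Lemma chattering_extension_le0 (t : R) : t <= 0 ->
  chattering_extension t = phi t.
Proof. by rewrite /chattering_extension => ->. Qed.

(** Starting from 0 with Lipschitz constant 3, the state stays within 10 on [[0, 1]]; the right-hand
    side is then the absolute value of the control, which is the derivative of the state. *)
Lemma chattering_admissible : admissible phi chattering_extension u.
Proof.
have ub := chattering_control_bounds N.
have lip (s t : R) : 0 <= s -> 0 <= t ->
    `|chattering_extension s - chattering_extension t| <= 3 * `|s - t|.
  by move=> s0 t0; rewrite !chattering_extension_ge0//; exact: chattering_state_lipschitz.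
have yphi (t : R) : `[-2, 0]%classic t -> chattering_extension t = phi t.
  by rewrite /= in_itv /= => /andP[_]; exact: chattering_extension_le0.
split => //.
- split; first exact: measurable_funTS (chattering_control_measurable N0).
  exact/aeW.
(* Continuity is glued from two closed pieces: [phi] up to 0 and the Lipschitz state afterwards. *)
- have -> : (`[-2, 1]%classic : set R) = `[-2, 0] `|` `[0, 1].
    apply/seteqP; split => t /=; rewrite !in_itv /=; last by lra.
    by move=> tI; have [t0|t0] := leP t 0; [left|right]; lra.
  apply: withinU_continuous; try exact: interval_closed.
    apply: (@subspace_eq_continuous _ _ _ phi chattering_extension) => // t.
    by rewrite inE => /yphi.
  apply: (@subspace_eq_continuous _ _ _ (chattering_state N) chattering_extension).
    move=> t; rewrite inE /= in_itv /= => /andP[t0 _].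
    by rewrite chattering_extension_ge0.
  apply: continuous_subspaceT => t; apply/cvgrPdist_le => e e0.
  exists (e / 3) => /=; first by rewrite divr_gt0.
  move=> s /= ts; rewrite (le_trans (chattering_state_lipschitz N0 _ _))//.
  by move: ts => /=; lra.
- exists 3 => s t /=; rewrite !in_itv /= => /andP[s0 _] /andP[t0 _]; exact: lip.
- have := chattering_ae_derive N0; apply: ae_imply => t [dz Dz].
  rewrite /= in_itv /= => t01.
  have eqy : {near t, chattering_state N =1 chattering_extension}.
    near=> s; symmetry; apply: chattering_extension_ge0.
    have : s \in (`]0, 1[ : interval R); last by rewrite in_itv /=; lra.
    by near: s; apply: near_in_itvoo; rewrite in_itv.
  split; first exact: near_eq_derivable dz.
  rewrite -(near_eq_derive _ eqy) Dz; symmetry; apply: rhs_eq_norm => //.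
  + by apply: (history_value hphi2 yphi); lra.
  + by apply: (history_value hphi2 yphi); lra.
  + apply: (extension_bounded hphi1 hphi2 yphi) => // s sI.
    rewrite chattering_extension_ge0; last by lra.
    have := chattering_state_lipschitz N0 s 0.
    rewrite chattering_state0 !subr0 (@ger0_norm _ s); lra.
Unshelve. all: by end_near. Qed.

(** The terminal term vanishes, the control integrates to 1, and only the tracking error contributes
    to the excess [N^-1]. *)
Lemma chattering_cost_le (n : nat) : N = n.+1%:R ->
  (cost chattering_extension u <= (1 + N^-1)%:E)%E.
Proof.
move=> NE; have ya := chattering_admissible.
have [[mu_ _] cy /W1inf01P[K yK] _ _] := ya.
have mv := chattering_control_measurable N0.
have vb := chattering_control_bounds N.
have cy01 : {within `[0, 1], continuous chattering_extension}.
  apply: continuous_subspaceW cy => t /=; rewrite !in_itv /=; lra.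
have v3 t : `|u t| <= 3 by rewrite ler_norml; have := vb t; lra.
have nv3 t : `| `|u t| | <= 3 by rewrite normr_id.
have mnv : measurable_fun setT (fun t => `|u t|) by exact: measurableT_comp.
have y1 : chattering_extension 1 - chattering_extension 0
    = \int[mu]_(t in `[0, 1]) `|u t|.
  apply: (lipschitz_FTC ler01 yK mnv nv3).
  exact: (admissible_derive hphi1 hphi2 hphi0 ya).
move: y1; rewrite !chattering_extension_ge0// chattering_state0// subr0.
rewrite (chattering_state1 (n := n.+1))// => y1.
have inv : mu.-integrable `[0, 1] (EFin \o (fun t => `|u t|)).
  exact: bounded_integrable_itv nv3 _ _ _ _.
have i2nv : mu.-integrable `[0, 1] (EFin \o (fun t => 2 * `|u t|)).
  exact: (@integrableZl _ _ R mu _ _ 2 _ inv).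
have icst c : mu.-integrable `[0, 1] (EFin \o cst c).
  by apply: (@bounded_integrable_itv _ _ `|c|).
have -> := costE cy01 mu_ mv vb (aeW _ (fun t _ => erefl)).
(* The values 3 and -1 satisfy [u = 2 |u| - 3], and the integral of [|u|] is the increment 2 of the
   state. *)
have -> : \int[mu]_(t in `[0, 1]) u t = 1.
  rewrite (@eq_Rintegral _ _ _ mu _ (fun t => 2 * `|u t| + cst (- 3) t)).
    by rewrite RintegralD// RintegralZl// Rintegral_cst// fine_lebesgue_itv// -y1; lra.
  by move=> t _; rewrite /chattering_control; case: ifP => _ /=;
    rewrite ?normrN ?normr1 ?ger0_norm//; lra.
rewrite chattering_extension_ge0// (chattering_state1 (n := n.+1))// subrr normr0.
rewrite lee_fin mulr0 addr0 addrC lerD2l.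
have : \int[mu]_(t in `[0, 1]) tracking_error chattering_extension t
    <= \int[mu]_(t in `[0, 1]) cst N^-1 t.
  apply: le_Rintegral => //; first exact: tracking_error_integrable.
  move=> t /=; rewrite in_itv /= => /andP[t0 _].
  rewrite /tracking_error chattering_extension_ge0//.
  have := chattering_state_tracking N0 t => /andP[e0 eN].
  (* The deviation lies between 0 and [N^-1 <= 1], so its square is at most [N^-1]. *)
  have N1 : N^-1 <= 1 by rewrite NE invf_le1 ?ler1n// ltr0n.
  by rewrite ger0_norm// expr2; nra.
by rewrite Rintegral_cst// fine_lebesgue_itv// subr0 mulr1.
Qed.

End Competitor.
Unset Implicit Arguments.
Set Strict Implicit.

Theorem theorem3p5 (R : realType) (phi : R -> R)
  (hphi1 : phi @` `[-2, -1]%classic = `[-10, 10]%classic)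
  (hphi2 : phi @` `[-1, 0]%classic = `[-10, 10]%classic)
  (hphi0 : phi 0 = 0) :
  ~ exists x u : R -> R,
      admissible phi x u /\
      (forall y v : R -> R, admissible phi y v -> (cost x u <= cost y v)%E).
Proof.
move=> [x [u [xu opt]]].
have [c c1 cxu] := cost_gt1 hphi1 hphi2 hphi0 xu.
(* Continuity of [phi] is inherited from the state of the supposed minimizer. *)
have cphi : {within `[-2, 0], continuous phi}.
  have [_ cx _ _ xphi] := xu.
  apply: (@subspace_eq_continuous _ _ _ x phi).
    by move=> t; rewrite inE => /xphi.
  apply: continuous_subspaceW cx => t /=; rewrite !in_itv /=; lra.
(* This makes [n.+1] exceed [1 / (c - 1)], so the competitor costs at most [1 + 1 / n.+1 < c]. *)
pose n := Num.truncn (c - 1)^-1.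
have N0 : 0 < n.+1%:R :> R by rewrite ltr0n.
have nc : (n.+1%:R : R)^-1 < c - 1.
  by rewrite invf_plt ?posrE ?subr_gt0// truncnS_gt.
have := chattering_cost_le hphi1 hphi2 hphi0 cphi N0 (erefl _).
move=> /(le_trans (opt _ _ (chattering_admissible hphi1 hphi2 hphi0 cphi N0))).
by rewrite cxu lee_fin -lerBlDl leNgt nc.
Qed.
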